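(* Let $(h^n,p^n,u^n)_{0\le n\le N}$ be a solution of the scheme described in the context. For $i=1,2$, $\sigma\in\mathcal E^{(i)}$ and $0\le n\le N-1$, the following equality holds: $$\frac1{2\,\delta t}\bigl(h^{n+1}_{D_\sigma}(u^{n+1}_{i,\sigma})^2-h^n_{D_\sigma}(u^n_{i,\sigma})^2\bigr)+\frac1{2|D_\sigma|}\sum_{\epsilon\in\widetilde{\mathcal E}^{(i)}(D_\sigma)}F^n_{\sigma,\epsilon}(u^n_{i,\epsilon})^2+u^{n+1}_{i,\sigma}(\eth_i p^{n+1})_\sigma+g\,h^{n+1}_{\sigma,c}\,u^{n+1}_{i,\sigma}(\eth_i z)_\sigma=-R^{n+1}_{i,\sigma},$$ with $R^{n+1}_{i,\sigma}\ge0$ under the CFL-like restriction $$\forall\sigma\in\mathcal E^{(i)},\qquad\delta t\le\frac{|D_\sigma|\,h^{n+1}_{D_\sigma}}{\sum_{\epsilon\in\widetilde{\mathcal E}^{(i)}(D_\sigma)}(F^n_{\sigma,\epsilon})^-},$$ where $x^-=\max(-x,0)$.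
   Context: $\Omega\subset\mathbb R^2$ is a bounded connected open set which is a union of rectangles with edges orthogonal to the canonical basis vectors $e^{(1)},e^{(2)}$. $\mathcal M$ is a conforming structured (possibly non uniform) partition of $\Omega$ into rectangles $K$ (mass center $x_K$) with axis-parallel edges; $\mathcal E(K)$ is the set of edges of $K$; $\mathcal E^{(i)}$ is the set of all edges orthogonal to $e^{(i)}$ and $\mathcal E^{(i)}_{\rm int}$ the subset of internal ones, i.e. those of the form $\sigma=K|L=\partial K\cap\partial L$; the others lie on $\partial\Omega$. For $\sigma=K|L$ the dual cell is $D_\sigma=D_{K,\sigma}\cup D_{L,\sigma}$, where $D_{K,\sigma}$ is the half of $K$ adjacent to $\sigma$; for a boundary edge of $K$, $D_\sigma=D_{K,\sigma}$. $\widetilde{\mathcal E}^{(i)}(D_\sigma)$ is the set of edges of the rectangle $D_\sigma$, $\sigma\in\mathcal E^{(i)}$. $|\cdot|$ is the one- or two-dimensional measure; $g>0$ is the gravity constant; $\delta t=T/N>0$ is the time step ($N\ge1$ an integer). Scalar unknowns are one value per cell ($h_K$, $p_K$), and the topography is represented by one time-independent value $z_K$ per cell. The $i$-th velocity component is given by one value $u_{i,\sigma}$ per $\sigma\in\mathcal E^{(i)}$, equal to $0$ on boundary edges. Primal mass flux: $F_{K,\sigma}=|\sigma|h_\sigma u_{K,\sigma}$, $u_{K,\sigma}=u_{i,\sigma}\,n_{K,\sigma}\cdot e^{(i)}$ for $\sigma\in\mathcal E^{(i)}$ ($n_{K,\sigma}$ unit normal outward $K$), with $h_\sigma=h_K$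 if $u_{K,\sigma}\ge0$ and $h_\sigma=h_L$ otherwise for $\sigma=K|L$; $F_{K,\sigma}=0$ on boundary edges. Dual heights: $|D_\sigma|h_{D_\sigma}=|D_{K,\sigma}|h_K+|D_{L,\sigma}|h_L$ for $\sigma=K|L$, and $h_{D_\sigma}=h_K$ for a boundary edge of $K$. Centered heights: $h_{\sigma,c}=\frac12(h_K+h_L)$ for $\sigma=K|L$, and $h_{\sigma,c}=h_K$ for a boundary edge of $K$. Discrete gradient: for $\sigma=K|L\in\mathcal E^{(i)}_{\rm int}$ with $(x_L-x_K)\cdot e^{(i)}>0$, $(\eth_i q)_\sigma=\frac{|\sigma|}{|D_\sigma|}(q_L-q_K)$; $(\eth_i q)_\sigma=0$ for boundary edges. Dual mass fluxes $F_{\sigma,\epsilon}$ (outward $D_\sigma$), for $\sigma\in\mathcal E^{(i)}$: if $\epsilon$ is orthogonal to $e^{(i)}$ and lies in the interior of the cell $K$, with $\sigma,\sigma'$ the two edges of $K$ in $\mathcal E^{(i)}$, then $F_{\sigma,\epsilon}=\frac12(F_{K,\sigma'}-F_{K,\sigma})$. If $\epsilon$ is parallel to $e^{(i)}$, it is the union of halves of an edge $\tau$ of $K$ and an edge $\tau'$ of $L$ ($\sigma=K|L$) and $F_{\sigma,\epsilon}=\frac12(F_{K,\tau}+F_{L,\tau'})$; if $\sigma$ is a boundary edge of $K$, $\epsilon$ is half of an edge $\tau$ of $K$ and $F_{\sigma,\epsilon}=\frac12F_{K,\tau}$. Dual edges contained in $\partial\Omega$ have zero flux. The value $u_{i,\epsilon}$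 is the upwind one: $u_{i,\sigma}$ if $F_{\sigma,\epsilon}\ge0$, and otherwise $u_{i,\sigma'}$, where $D_{\sigma'}$, $\sigma'\in\mathcal E^{(i)}$, is the dual cell on the other side of $\epsilon$ (for $\epsilon$ parallel to $e^{(i)}$, $\sigma'$ is the edge collinear with $\sigma$ and sharing with it the endpoint that lies on $\epsilon$). The scheme: given $h^0$ and $u^0$ (cell averages of the initial height, and averages over the dual cells of internal edges of the initial velocity components, with zero values on boundary edges) and $p^0_K=\frac12g(h^0_K)^2$, for $0\le n\le N-1$ find $h^{n+1},p^{n+1}$ and $u^{n+1}$ (zero on boundary edges) such that $$\frac{1}{\delta t}(h_K^{n+1}-h_K^n)+\frac1{|K|}\sum_{\sigma\in\mathcal E(K)}F^n_{K,\sigma}=0,\qquad p_K^{n+1}=\tfrac12 g\,(h_K^{n+1})^2\qquad\forall K\in\mathcal M,$$ $$\frac1{\delta t}\bigl(h^{n+1}_{D_\sigma}u^{n+1}_{i,\sigma}-h^n_{D_\sigma}u^n_{i,\sigma}\bigr)+\frac1{|D_\sigma|}\sum_{\epsilon\in\widetilde{\mathcal E}^{(i)}(D_\sigma)}F^n_{\sigma,\epsilon}u^n_{i,\epsilon}+(\eth_i p^{n+1})_\sigma+g\,h^{n+1}_{\sigma,c}(\eth_i z)_\sigma=0\quad\forall\sigma\in\mathcal E^{(i)}_{\rm int},\ i=1,2 .$$ Superscripts $n$ denote time levels. The CFL-like restriction is understood as $\delta t\sum_\epsilon(F^n_{\sigma,\epsilon})^-\le|D_\sigma|h^{n+1}_{D_\sigma}$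 when the denominator vanishes. *)

(* Defs.v *)
From mathcomp Require Import all_boot all_order all_algebra.
From mathcomp Require Import all_classical all_reals all_analysis.
Set Implicit Arguments.
Unset Strict Implicit.
Unset Printing Implicit Defensive.
Import Order.TTheory GRing.Theory Num.Theory.
Import numFieldNormedType.Exports.
Local Open Scope classical_set_scope.
Local Open Scope ring_scope.

(** * Axis-parallel boxes of the plane *)

(* [ax1], [ax2] stand for the indices i = 1, 2 of the basis vectors. *)
Variant axis := ax1 | ax2.

Definition orth (i : axis) : axis := if i is ax1 then ax2 else ax1.

Definition coord {R : realType} (i : axis) (x : R * R) : R :=
  if i is ax1 then x.1 else x.2.

Definition set_coord {R : realType} (i : axis) (x : R * R) (a : R) : R * R :=
  if i is ax1 then (a, x.2) else (x.1, a).

(* A closed box is the pair (lower-left corner, upper-right corner).  Cells and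
   dual cells are boxes with two nonzero side lengths; an edge orthogonal to
   e^(i) is a box which is degenerate in direction i only. *)
Definition box (R : realType) : Type := ((R * R) * (R * R))%type.

Section Boxes.
Context {R : realType}.
Implicit Types (K L s : box R) (i j : axis).

Definition lo i K : R := coord i K.1.
Definition hi i K : R := coord i K.2.

Definition pts K : set (R * R) :=
  [set x | forall i, lo i K <= coord i x <= hi i K].

Definition rectangle K : Prop := forall i, lo i K < hi i K.

Definition center K : R * R :=
  ((lo ax1 K + hi ax1 K) / 2, (lo ax2 K + hi ax2 K) / 2).

Definition vertices K : seq (R * R) :=
  [seq (x, y) | x <- [:: lo ax1 K; hi ax1 K], y <- [:: lo ax2 K; hi ax2 K]].

(* The edge of K orthogonal to e^(i), on the upper ([b = true]) or lower side. *)
Definition face i (b : bool) K : box R :=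
  let a := if b then hi i K else lo i K in
  (set_coord i K.1 a, set_coord i K.2 a).

Definition edges_dir i K : seq (box R) := [:: face i false K; face i true K].
Definition edges K : seq (box R) := edges_dir ax1 K ++ edges_dir ax2 K.

(* The edge of K orthogonal to e^(i) other than s. *)
Definition opposite i K s : box R :=
  if s == face i false K then face i true K else face i false K.

Definition edge_axis s : axis := if lo ax1 s == hi ax1 s then ax1 else ax2.

Definition area K : R := (hi ax1 K - lo ax1 K) * (hi ax2 K - lo ax2 K).
Definition length s : R :=
  let j := orth (edge_axis s) in hi j s - lo j s.

(* Average over K with respect to the two-dimensional Lebesgue measure. *)
Definition is_average (f : R * R -> R) K (m : R) : Prop :=
  let mu := (@lebesgue_measure R \x @lebesgue_measure R)%E in
  mu.-integrable (pts K) (EFin \o f) /\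
  m = (area K)^-1 * Rintegral mu (pts K) f.

End Boxes.

(** * Domain and mesh *)

(* An open set "made of" finitely many rectangles is the interior of the union
   of the closed ones; the domain thus never lies on both sides of its
   boundary. *)
Definition domain {R : realType} (Omega : set (R * R)) : Prop :=
  [/\ open Omega, connected Omega,
      bounded_set Omega &
      exists2 rs : seq (box R), (forall r, r \in rs -> rectangle r) &
        Omega = interior [set x | exists2 r, r \in rs & pts r x]].

(* Two distinct closed cells are disjoint, or meet exactly at a common vertex,
   or meet exactly along a common (entire) edge. *)
Definition conforming {R : realType} (M : seq (box R)) : Prop :=
  forall K L, K \in M -> L \in M -> K != L ->
  [\/ pts K `&` pts L = set0,
      exists v, [/\ v \in vertices K, v \in vertices L &
                    pts K `&` pts L = [set v]] |
      exists s, [/\ s \in edges K, s \in edges L &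
                    pts K `&` pts L = pts s]].

(* The mesh need not be a subset of the cells of one global tensor-product grid;
   its local structure (four cells around each interior vertex) follows from
   conformity. *)
Record mesh {R : realType} (Omega : set (R * R)) (M : seq (box R)) : Prop := {
  mesh_uniq : uniq M;
  mesh_rectangle : forall K, K \in M -> rectangle K;
  mesh_cover : closure Omega = [set x | exists2 K, K \in M & pts K x];
  mesh_conforming : conforming M }.

Section Scheme.
Context {R : realType}.
Variables (M : seq (box R)).
Implicit Types (K L s e : box R) (i j : axis).

(* The set E^(i) of the edges of the mesh orthogonal to e^(i). *)
Definition mesh_edges i : seq (box R) := flatten [seq edges_dir i K | K <- M].

(* [:: K; L] (in either order) for s = K|L, and [:: K] for a boundary edge s
   of K. *)
Definition cells_of s : seq (box R) := [seq K <- M | s \in edges K].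

Definition internal s : bool := (1 < size (cells_of s))%N.

(* The half D_{K,s} of K adjacent to its edge s. *)
Definition half_cell i K s : box R :=
  let c := coord i (center K) in
  if s == face i false K then (K.1, set_coord i K.2 c)
  else (set_coord i K.1 c, K.2).

(* The smallest box containing K and L; for two half cells sharing an edge this
   is their union. *)
Definition join_box K L : box R :=
  ((Num.min (lo ax1 K) (lo ax1 L), Num.min (lo ax2 K) (lo ax2 L)),
   (Num.max (hi ax1 K) (hi ax1 L), Num.max (hi ax2 K) (hi ax2 L))).

Definition dual_cell i s : box R :=
  match cells_of s with
  | [:: K; L] => join_box (half_cell i K s) (half_cell i L s)
  | [:: K] => half_cell i K s
  | _ => s
  end.

(** ** Cell-based quantities at the edges *)

Definition dual_height (h : box R -> R) i s : R :=
  match cells_of s with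
  | [:: K; L] => (area (half_cell i K s) * h K + area (half_cell i L s) * h L)
                 / area (dual_cell i s)
  | [:: K] => h K
  | _ => 0
  end.

Definition centered_height (h : box R -> R) s : R :=
  match cells_of s with
  | [:: K; L] => (h K + h L) / 2
  | [:: K] => h K
  | _ => 0
  end.

Definition gradient (q : box R -> R) i s : R :=
  match cells_of s with
  | [:: K; L] =>
      length s / area (dual_cell i s) *
      (if 0 < coord i (center L) - coord i (center K) then q L - q K
       else q K - q L)
  | _ => 0
  end.

(** ** Mass fluxes *)

(* u_{K,s} = u_{i,s} n_{K,s}.e^(i), where e^(i) is orthogonal to s. *)
Definition outward_velocity (u : axis -> box R -> R) K s : R :=
  let i := edge_axis s in
  u i s * (if s == face i true K then 1 else -1).

Definition primal_flux (h : box R -> R) (u : axis -> box R -> R) K s : R :=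
  if [seq L <- cells_of s | L != K] is L :: _ then
    let uKs := outward_velocity u K s in
    length s * (if 0 <= uKs then h K else h L) * uKs
  else 0.

(* The cell adjacent to s whose interior contains the (relative interior of
   the) edge e of D_s orthogonal to e^(i), if there is one; otherwise s is a
   boundary edge and e = s. *)
Definition crossed_cell i s e : option (box R) :=
  ohead [seq K <- cells_of s | lo i K < lo i e < hi i K].

(* The edge of K collinear with the edge e, parallel to e^(i), of a dual cell. *)
Definition carrier i K e : box R :=
  let j := orth i in face j (lo j e == hi j K) K.

(* F_{s,e} for e an edge of D_s, s in E^(i); it vanishes for e included in the
   boundary of the domain, since primal fluxes vanish on boundary edges. *)
Definition dual_flux (h : box R -> R) (u : axis -> box R -> R) i s e : R :=
  let F := primal_flux h u in
  if lo i e == hi i e then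
    if crossed_cell i s e is Some K then (F K (opposite i K s) - F K s) / 2
    else 0
  else
    match cells_of s with
    | [:: K; L] => (F K (carrier i K e) + F L (carrier i L e)) / 2
    | [:: K] => F K (carrier i K e) / 2
    | _ => 0
    end.

(* The edge s' in E^(i) such that D_s' lies on the other side of e.  The default
   value s is returned only if e is included in the boundary of the domain. *)
Definition across i s e : box R :=
  if lo i e == hi i e then
    if crossed_cell i s e is Some K then opposite i K s else s
  else
    let j := orth i in
    head s [seq s' <- mesh_edges i | (lo i s' == lo i s) &&
              (if lo j e == hi j s then lo j s' == hi j s
               else hi j s' == lo j s)].

Definition upwind_velocity (h : box R -> R) (u : axis -> box R -> R) i s e : R :=
  if 0 <= dual_flux h u i s e then u i s else u i (across i s e).

(** ** The scheme *)

Record scheme_solution (g dt : R) (N : nat) (z : box R -> R)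
    (h_init : R * R -> R) (u_init : axis -> R * R -> R)
    (h p : nat -> box R -> R) (u : nat -> axis -> box R -> R) : Prop := {
  sol_h0 : forall K, K \in M -> is_average h_init K (h 0%N K);
  sol_u0 : forall i s, s \in mesh_edges i -> internal s ->
    is_average (u_init i) (dual_cell i s) (u 0%N i s);
  sol_p0 : forall K, K \in M -> p 0%N K = 2^-1 * g * h 0%N K ^+ 2;
  sol_boundary : forall n i s, (n <= N)%N -> s \in mesh_edges i ->
    ~~ internal s -> u n i s = 0;
  sol_mass : forall n K, (n < N)%N -> K \in M ->
    dt^-1 * (h n.+1 K - h n K)
    + (area K)^-1 * \sum_(s <- edges K) primal_flux (h n) (u n) K s = 0;
  sol_pressure : forall n K, (n < N)%N -> K \in M ->
    p n.+1 K = 2^-1 * g * h n.+1 K ^+ 2;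
  sol_momentum : forall n i s, (n < N)%N -> s \in mesh_edges i -> internal s ->
    dt^-1 * (dual_height (h n.+1) i s * u n.+1 i s
             - dual_height (h n) i s * u n i s)
    + (area (dual_cell i s))^-1 *
      (\sum_(e <- edges (dual_cell i s))
         dual_flux (h n) (u n) i s e * upwind_velocity (h n) (u n) i s e)
    + gradient (p n.+1) i s
    + g * centered_height (h n.+1) s * gradient z i s = 0 }.

Definition neg_part (x : R) : R := Num.max (- x) 0.

(* The restriction at time level n for the edge s, where h' is the height at
   time level n+1; for a vanishing denominator it is read in the form cleared
   of the denominator. *)
Definition cfl (dt : R) (h h' : box R -> R) (u : axis -> box R -> R) i s : Prop :=
  let S := \sum_(e <- edges (dual_cell i s)) neg_part (dual_flux h u i s e) in
  let m := area (dual_cell i s) * dual_height h' i s in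
  if S == 0 then dt * S <= m else dt <= m / S.

End Scheme.

(* Main.v *)
(** The halves of the mass balances of the two cells K and L adjacent to an
    internal edge add up to a mass balance on the dual cell, the fluxes through
    K|L cancelling each other.  Write a = |D| h'_D / dt, F_e for the dual
    fluxes, v and v' for the old and new velocities and w_e for the upwind ones.
    Multiplying the momentum balance by v' and eliminating h_D with this mass
    balance gives
      |D| Rem = (a - sum F_e^-) (v' - v)^2 / 2 + sum F_e^- (w_e - v')^2 / 2,
    because w_e = v when F_e >= 0; the CFL condition is a >= sum F_e^-. *)
Require Import Defs.
From mathcomp Require Import all_boot all_order all_algebra.
From mathcomp Require Import all_classical all_reals all_analysis.
From mathcomp Require Import ring lra.
Set Implicit Arguments.
Unset Strict Implicit.
Unset Printing Implicit Defensive.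
Import Order.TTheory GRing.Theory Num.Theory.
Import numFieldNormedType.Exports.
Local Open Scope classical_set_scope.
Local Open Scope ring_scope.

(** * Faces, half cells and overlaps of boxes *)

Section BoxGeometry.
Context {R : realType}.
Implicit Types (K L s : box R) (i j : axis) (b : bool).

Lemma lo_face i b K : lo i (face i b K) = if b then hi i K else lo i K.
Proof. by case: i; case: b. Qed.

Lemma hi_face i b K : hi i (face i b K) = if b then hi i K else lo i K.
Proof. by case: i; case: b. Qed.

Lemma hi_face_orth i b K : hi (orth i) (face i b K) = hi (orth i) K.
Proof. by case: i. Qed.

Lemma lo_orth_face i b K : lo i (face (orth i) b K) = lo i K.
Proof. by case: i. Qed.

Lemma hi_orth_face i b K : hi i (face (orth i) b K) = hi i K.
Proof. by case: i. Qed.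

Lemma areaE i K :
  area K = (hi i K - lo i K) * (hi (orth i) K - lo (orth i) K).
Proof. by case: i; rewrite /area //= mulrC. Qed.

Lemma area_gt0 K : rectangle K -> 0 < area K.
Proof. by move=> rK; rewrite mulr_gt0 // subr_gt0. Qed.

Lemma face_neq i K : rectangle K -> (face i true K == face i false K) = false.
Proof.
move=> /(_ i) rK; apply/negP => /eqP /(congr1 (lo i)).
by rewrite !lo_face => E; rewrite E ltxx in rK.
Qed.

Lemma edge_axis_face i b K : rectangle K -> edge_axis (face i b K) = i.
Proof.
move=> rK; rewrite /edge_axis; case: i; first by rewrite lo_face hi_face eqxx.
by rewrite (lo_orth_face ax1) (hi_orth_face ax1) lt_eqF.
Qed.

Lemma edges_face i b K : face i b K \in edges K.
Proof. by rewrite mem_cat !inE; case: i; case: b; rewrite eqxx ?orbT. Qed.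

Lemma edgesP s K : s \in edges K -> exists i b, s = face i b K.
Proof.
by rewrite mem_cat !inE => /orP[/orP[]|/orP[]] /eqP ->;
  [exists ax1, false|exists ax1, true|exists ax2, false|exists ax2, true].
Qed.

Lemma mem_edges_dir i s K : s \in edges_dir i K -> exists b, s = face i b K.
Proof. by rewrite !inE => /orP[] /eqP ->; [exists false | exists true]. Qed.

Lemma sum_edges i K (f : box R -> R) :
  \sum_(e <- edges K) f e = f (face i false K) + f (face i true K)
    + (f (face (orth i) false K) + f (face (orth i) true K)).
Proof.
by case: i; rewrite /edges /edges_dir /= !big_cons big_nil; ring.
Qed.

(** An edge of [K] orthogonal to the other axis has positive extent in direction [i]. *)
Lemma edge_of_axis i s K : rectangle K -> s \in edges K -> lo i s = hi i s ->
  exists b, s = face i b K.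
Proof.
move=> rK /edgesP[j [b ->]]; have := rK i.
by case: i; case: j; rewrite /lo /hi /= => lt E; (try by exists b);
  rewrite E ltxx in lt.
Qed.

Lemma half_cell_face i b K : rectangle K ->
  half_cell i K (face i b K) =
  if b then (set_coord i K.1 (Defs.coord i (Defs.center K)), K.2)
  else (K.1, set_coord i K.2 (Defs.coord i (Defs.center K))).
Proof. by rewrite /half_cell; case: b => rK; rewrite ?face_neq // eqxx. Qed.

Lemma area_half_cell i b K : rectangle K ->
  area (half_cell i K (face i b K)) = area K / 2.
Proof.
move=> rK; rewrite half_cell_face // /area.
by case: i b => -[] /=; rewrite /lo /hi /=; field.
Qed.

Lemma area_edge i b K : area (face i b K) = 0.
Proof. by rewrite (areaE i) lo_face hi_face subrr mul0r. Qed.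

Lemma opposite_face i b K : rectangle K ->
  opposite i K (face i b K) = face i (~~ b) K.
Proof. by move=> rK; rewrite /opposite; case: b; rewrite ?face_neq ?eqxx. Qed.

Lemma join_boxC K L : join_box K L = join_box L K.
Proof.
by rewrite /join_box ![Num.min (lo _ K) _]minC ![Num.max (hi _ K) _]maxC.
Qed.

(* The overlap contains two points differing in both coordinates, whereas a
   vertex or an edge has a constant coordinate. *)
Lemma overlapping_not_conforming (M : seq (box R)) K L : conforming M ->
  K \in M -> L \in M -> K != L ->
  ~ (forall i, Num.max (lo i K) (lo i L) < Num.min (hi i K) (hi i L)).
Proof.
move=> cM KM LM KL ov.
pose x : R * R :=
  (Num.max (lo ax1 K) (lo ax1 L), Num.max (lo ax2 K) (lo ax2 L)).
pose y : R * R :=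
  (Num.min (hi ax1 K) (hi ax1 L), Num.min (hi ax2 K) (hi ax2 L)).
have xy i : Defs.coord i x < Defs.coord i y by case: i; exact: ov.
have xI : (pts K `&` pts L) x.
  split=> i; have := ov i; rewrite /x; case: i;
    rewrite /= gt_max !lt_min => /andP[/andP[? ?] /andP[? ?]];
    by rewrite /= le_max lexx ?orbT /= ge_max !ltW.
have yI : (pts K `&` pts L) y.
  split=> i; have := ov i; rewrite /y; case: i;
    rewrite /= gt_max !lt_min => /andP[/andP[? ?] /andP[? ?]];
    by rewrite ge_min lexx ?orbT /= le_min !ltW.
case: (cM K L KM LM KL) => [E|[v [_ _ E]]|[s [sK _ E]]];
  rewrite E in xI yI => //.
- by have := xy ax1; rewrite xI yI ltxx.
- have [i [b Es]] := edgesP sK.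
  have := xy i; move: (xI i) (yI i); rewrite Es lo_face hi_face.
  move=> /andP[le1 _] /andP[_ le2].
  by rewrite ltNge (le_trans le2 le1).
Qed.

(** Both rectangles lie on the same side of the common face and have the same transverse extent, so
    their interiors meet; conformity excludes this for distinct cells. *)
Lemma same_face_overlap i b K L : rectangle K -> rectangle L ->
  face i b K = face i b L ->
  forall j, Num.max (lo j K) (lo j L) < Num.min (hi j K) (hi j L).
Proof.
move=> rK rL E j; have := rK j; have := rL j.
have := congr1 (lo j) E; have := congr1 (hi j) E.
rewrite gt_max !lt_min.
by case: i {E}; case: j; case: b; rewrite /lo /hi /= => E1 E2 H1 H2;
  rewrite H1 H2 /=; rewrite ?andbT; apply/andP; split; lra.
Qed.

Lemma rectangle_orth i K :
  lo i K < hi i K -> lo (orth i) K < hi (orth i) K -> rectangle K.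
Proof. by move=> H1 H2 j; case: i H1 H2; case: j. Qed.

Lemma rectangle_half_cell i b K :
  rectangle K -> rectangle (half_cell i K (face i b K)).
Proof.
move=> rK; rewrite half_cell_face //.
have H1 := rK i; have H2 := rK (orth i).
apply: (rectangle_orth (i := i));
  by case: i b H1 H2 => -[]; rewrite /lo /hi /=; lra.
Qed.

(** The half cells share a whole face, so their bounding box is their union; in direction [i] it
    runs from the middle of [K] to the middle of [L]. *)
Lemma join_half_cells i K L : rectangle K -> rectangle L ->
  face i true K = face i false L ->
  let J := join_box (half_cell i K (face i true K))
                    (half_cell i L (face i false L)) in
  [/\ lo i J = (lo i K + hi i K) / 2, hi i J = (lo i L + hi i L) / 2,
      lo (orth i) J = lo (orth i) K & hi (orth i) J = hi (orth i) K].
Proof.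
move=> rK rL E; rewrite !half_cell_face //=.
have := rK i; have := rL i.
have := congr1 (lo i) E; have := congr1 (lo (orth i)) E.
have := congr1 (hi (orth i)) E.
case: i {E} => /=; rewrite /lo /hi /= => E1 E2 E3 H1 H2; split;
  rewrite ?E1 ?E2 ?minxx ?maxxx // ?min_l ?max_r //; lra.
Qed.

End BoxGeometry.

(** * Energy inequality for an upwind balance *)

(** In the application [b] is |D| h_D / dt, [G] is |D| times the pressure and topography terms, and
    the quantity bounded by 0 is -|D| Rem. *)
Lemma upwind_energy (R : realType) (I : Type) (r : seq I)
    (F w : I -> R) (a b v v' G : R) :
  b = a + \sum_(e <- r) F e ->
  a * v' - b * v + \sum_(e <- r) F e * w e + G = 0 ->
  (forall e, 0 <= F e -> w e = v) ->
  \sum_(e <- r) neg_part (F e) <= a ->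
  (a * v' ^+ 2 - b * v ^+ 2) / 2 + (\sum_(e <- r) F e * w e ^+ 2) / 2
    + v' * G <= 0.
Proof.
move=> Eb mom up cfl.
(* Each summand on the left is F ((w - v')^2 - (v' - v)^2): it vanishes for F >= 0, where w = v, and
   is at most F^- (v' - v)^2 for F < 0. *)
have key : \sum_(e <- r) F e * w e ^+ 2 - 2 * v' * (\sum_(e <- r) F e * w e)
   + (2 * v * v' - v ^+ 2) * (\sum_(e <- r) F e)
   <= (v' - v) ^+ 2 * \sum_(e <- r) neg_part (F e).
  rewrite !mulr_sumr -sumrB -big_split /=; apply: ler_sum => e _.
  rewrite /neg_part; case: (lerP 0 (F e)) => [Fe|/ltW Fe].
    by rewrite up // max_r ?oppr_le0 //; lra.
  rewrite max_l ?oppr_ge0 // -subr_ge0.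
  rewrite [X in 0 <= X](_ : _ = - F e * (w e - v') ^+ 2); last by ring.
  by rewrite mulr_ge0 ?sqr_ge0 // oppr_ge0.
(* Once [b] and [G] are eliminated, twice the left side of the goal is the left side of [key] minus
   a (v' - v)^2. *)
have := ler_wpM2l (sqr_ge0 (v' - v)) cfl.
rewrite Eb in mom *; have -> : G = - (a * v' - (a + \sum_(e <- r) F e) * v
    + \sum_(e <- r) F e * w e) by lra.
move: key; set S0 := \sum_(_ <- _) F _; set S1 := \sum_(_ <- _) (_ * w _);
set S2 := \sum_(_ <- _) _; set S3 := \sum_(_ <- _) _ => key bd.
by have := le_trans key bd; lra.
Qed.

(** * Internal edges and their dual cells *)

(** Two cells on the same side of [s] would overlap, so one lies below and the other above it in
    direction [i]. The final disjunction remains because [cells_of] follows the order of [M]. *)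
Lemma internal_edge_cells (R : realType) (Omega : set (R * R))
    (M : seq (box R)) (i : axis) (s K L : box R) :
  mesh Omega M -> s \in mesh_edges M i -> cells_of M s = [:: K; L] ->
  exists K' L', [/\ K' \in M, L' \in M, s = face i true K', s = face i false L'
    & cells_of M s = [:: K'; L'] \/ cells_of M s = [:: L'; K']].
Proof.
move=> hM /flattenP[_ /mapP[K0 K0M ->] sK0] cs.
have deg : lo i s = hi i s.
  by have [b ->] := mem_edges_dir sK0; rewrite lo_face hi_face.
have inM X : X \in [:: K; L] -> X \in M /\ s \in edges X.
  by rewrite -cs mem_filter => /andP[].
have [KM sK] := inM K (mem_head _ _).
have [LM sL] : L \in M /\ s \in edges L by apply: inM; rewrite !inE eqxx orbT.
have KL : K != L.
  have : uniq (cells_of M s) by rewrite filter_uniq // (mesh_uniq hM).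
  by rewrite cs /= inE andbT.
have rK := mesh_rectangle hM KM; have rL := mesh_rectangle hM LM.
have [b Eb] := edge_of_axis rK sK deg; have [b' Eb'] := edge_of_axis rL sL deg.
have [E|] := eqVneq b b'; last first.
  case: b b' Eb Eb' => -[] //= Eb Eb' _.
    by exists K, L; split=> //; left.
  by exists L, K; split=> //; right.
rewrite E in Eb.
by case: (overlapping_not_conforming (mesh_conforming hM) KM LM KL);
  apply: (same_face_overlap (i := i) (b := b')); rewrite // -Eb.
Qed.

Section InternalEdge.
Context {R : realType}.
Variables (M : seq (box R)) (i : axis) (s K L : box R).
Hypotheses (rK : rectangle K) (rL : rectangle L).
Hypotheses (sK : s = face i true K) (sL : s = face i false L).
Hypothesis cs : cells_of M s = [:: K; L] \/ cells_of M s = [:: L; K].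
Implicit Types (h : box R -> R) (u : axis -> box R -> R).

Let D := dual_cell M i s.

Let hi_lo : hi i K = lo i L.
Proof. by have := congr1 (lo i) sK; rewrite {1}sL !lo_face => <-. Qed.

Let hiLK : hi (orth i) L = hi (orth i) K.
Proof. by have := congr1 (hi (orth i)) sK; rewrite {1}sL !hi_face_orth. Qed.

Let dual_cell_join : D = join_box (half_cell i K s) (half_cell i L s).
Proof. by rewrite /D /dual_cell; case: cs => ->; rewrite // join_boxC. Qed.

Lemma dual_cell_bounds : [/\ lo i D = (lo i K + hi i K) / 2,
  hi i D = (lo i L + hi i L) / 2, lo (orth i) D = lo (orth i) K
  & hi (orth i) D = hi (orth i) K].
Proof.
(* The odd occurrences of [s], one per conjunct, are those in [half_cell i K s]. *)
rewrite dual_cell_join {1 3 5 7}sK !sL; apply: join_half_cells => //.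
by rewrite -sK.
Qed.

Lemma rectangle_dual_cell : rectangle D.
Proof.
have [l1 h1 l2 h2] := dual_cell_bounds.
have := rK i; have := rL i; have := rK (orth i); have := hi_lo => E r2 r1 r0.
by apply: (rectangle_orth (i := i)); rewrite ?l1 ?h1 ?l2 ?h2 -?E; lra.
Qed.

Lemma dual_height_mean h :
  area D * dual_height M h i s = area K / 2 * h K + area L / 2 * h L.
Proof.
have D0 : area D != 0 by rewrite gt_eqF // area_gt0 //;
  exact: rectangle_dual_cell.
have aK : area (half_cell i K s) = area K / 2 by rewrite sK area_half_cell.
have aL : area (half_cell i L s) = area L / 2 by rewrite sL area_half_cell.
by rewrite /dual_height -/D; case: cs => ->; rewrite aK aL; field.
Qed.

Let neqLK : (L == K) = false.
Proof.
apply/negP => /eqP E; have := rK i; have := hi_lo.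
by rewrite E => ->; rewrite ltxx.
Qed.

(** For a nonzero velocity both cells select the same upwind height. For a zero one each selects its
    own height, but both fluxes vanish. *)
Lemma primal_flux_antisym h u :
  primal_flux M h u L s = - primal_flux M h u K s.
Proof.
have neqKL : (K == L) = false by rewrite eq_sym neqLK.
have oK : outward_velocity u K s = u i s.
  by rewrite /outward_velocity sK edge_axis_face // eqxx mulr1.
have oL : outward_velocity u L s = - u i s.
  by rewrite /outward_velocity sL edge_axis_face // eq_sym face_neq // mulrN1.
rewrite /primal_flux; case: cs => ->;
  rewrite /= neqLK neqKL !eqxx /= oK oL oppr_ge0;
  case: (ltrgtP (u i s) 0) => [||->];
  by rewrite ?oppr0 ?mulr0 ?mulrN ?opprK ?oppr0.
Qed.

(** The dual edges orthogonal to e^(i) bring in F_{K,s} and F_{L,s} with a minus sign, the right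
    side with a plus sign; both pairs sum to 0 by antisymmetry. *)
Lemma dual_flux_sum h u :
  \sum_(e <- edges D) dual_flux M h u i s e =
  (\sum_(e <- edges K) primal_flux M h u K e
   + \sum_(e <- edges L) primal_flux M h u L e) / 2.
Proof.
have [l1 h1 l2 h2] := dual_cell_bounds.
have r0 := rK i; have r1 := rL i; have r2 := rK (orth i).
(* The two faces of [D] orthogonal to e^(i) pass through the centers of [K] and [L], hence each
   crosses exactly one of these cells. *)
have cc1 : crossed_cell M i s (face i false D) = Some K.
  have eL : (lo i L < lo i (face i false D) < hi i L) = false.
    by rewrite lo_face l1 -hi_lo; apply/negP => /andP[]; lra.
  have eK : lo i K < lo i (face i false D) < hi i K.
    by rewrite lo_face l1; apply/andP; split; lra.
  by rewrite /crossed_cell; case: cs => ->; rewrite /= eL eK.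
have cc2 : crossed_cell M i s (face i true D) = Some L.
  have eK : (lo i K < lo i (face i true D) < hi i K) = false.
    by rewrite lo_face h1 hi_lo; apply/negP => /andP[]; lra.
  have eL : lo i L < lo i (face i true D) < hi i L.
    by rewrite lo_face h1; apply/andP; split; lra.
  by rewrite /crossed_cell; case: cs => ->; rewrite /= eL eK.
have par b : dual_flux M h u i s (face (orth i) b D) =
    (primal_flux M h u K (face (orth i) b K)
     + primal_flux M h u L (face (orth i) b L)) / 2.
  (* [carrier] finds the side by comparing coordinates, which works for both cells since [K], [L]
     and [D] have the same transverse extent. *)
  have E X : hi (orth i) X = hi (orth i) K ->
      carrier i X (face (orth i) b D) = face (orth i) b X.
    move=> EX; rewrite /carrier EX lo_face l2 h2.
    by case: b; rewrite ?eqxx // lt_eqF.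
  rewrite /dual_flux lo_orth_face hi_orth_face lt_eqF;
    last exact: rectangle_dual_cell.
  by case: cs => ->; rewrite (E K) // (E L hiLK) // addrC.
have oK : opposite i K s = face i false K by rewrite sK opposite_face.
have oL : opposite i L s = face i true L by rewrite sL opposite_face.
rewrite (sum_edges i D) !par {1 2}/dual_flux !lo_face !hi_face !eqxx cc1 cc2.
rewrite (sum_edges i K) (sum_edges i L) oK oL -sK -sL primal_flux_antisym.
by field.
Qed.

End InternalEdge.

(** * Mass balance and CFL condition on a dual cell *)

Lemma dual_mass_balance (R : realType) (M : seq (box R)) (i : axis)
    (s K L : box R) (dt : R) (h h' : box R -> R) (u : axis -> box R -> R) :
  rectangle K -> rectangle L -> s = face i true K -> s = face i false L ->
  cells_of M s = [:: K; L] \/ cells_of M s = [:: L; K] ->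
  (forall X, X \in [:: K; L] -> dt^-1 * (h' X - h X)
     + (area X)^-1 * \sum_(e <- edges X) primal_flux M h u X e = 0) ->
  dt^-1 * (area (dual_cell M i s) * dual_height M h i s) =
  dt^-1 * (area (dual_cell M i s) * dual_height M h' i s)
    + \sum_(e <- edges (dual_cell M i s)) dual_flux M h u i s e.
Proof.
move=> rK rL sK sL cs mass.
rewrite !(dual_height_mean rK rL sK sL cs) (dual_flux_sum rK rL sK sL cs).
have cell X : X \in [:: K; L] -> rectangle X ->
    \sum_(e <- edges X) primal_flux M h u X e
    = - (dt^-1 * area X * (h' X - h X)).
  move=> XKL /area_gt0/lt0r_neq0 aX; have := mass X XKL.
  move=> /eqP; rewrite addrC addr_eq0 => /eqP /(congr1 ( *%R (area X))).
  by rewrite mulVKf // => ->; ring.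
by rewrite !cell ?inE ?eqxx ?orbT //; move: dt^-1 => k; field.
Qed.

(** A nonzero [S] is positive, being a sum of nonnegative terms, so both branches of [cfl] amount to
    dt S <= m. *)
Lemma cfl_clear (R : realType) (M : seq (box R)) (dt : R)
    (h h' : box R -> R) (u : axis -> box R -> R) i s :
  0 < dt -> cfl M dt h h' u i s ->
  \sum_(e <- edges (dual_cell M i s)) neg_part (dual_flux M h u i s e)
  <= dt^-1 * (area (dual_cell M i s) * dual_height M h' i s).
Proof.
move=> dt0; rewrite /cfl; set S := \sum_(_ <- _) _.
have S0 : 0 <= S.
  by apply: sumr_ge0 => e _; rewrite /neg_part le_max lexx orbT.
rewrite ler_pdivlMl //; case: eqVneq => // nS.
by rewrite ler_pdivlMr // lt_neqAle eq_sym nS.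
Qed.

(** * Kinetic energy balance and sign of the remainder *)

Theorem lemma3 (R : realType) (Omega : set (R * R)) (M : seq (box R))
    (g T dt : R) (N : nat) (z : box R -> R)
    (h_init : R * R -> R) (u_init : axis -> R * R -> R)
    (h p : nat -> box R -> R) (u : nat -> axis -> box R -> R)
    (hOmega : domain Omega) (hM : mesh Omega M)
    (hg : 0 < g) (hN : (1 <= N)%N) (hdt : dt = T / N%:R) (hdt0 : 0 < dt)
    (hsol : scheme_solution M g dt N z h_init u_init h p u) :
  exists Rem : nat -> axis -> box R -> R,
    forall (i : axis) (n : nat), (n < N)%N ->
    (forall s, s \in mesh_edges M i ->
       (2 * dt)^-1 * (dual_height M (h n.+1) i s * u n.+1 i s ^+ 2
                      - dual_height M (h n) i s * u n i s ^+ 2)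
       + (2 * area (dual_cell M i s))^-1 *
         (\sum_(e <- edges (dual_cell M i s))
            dual_flux M (h n) (u n) i s e
            * upwind_velocity M (h n) (u n) i s e ^+ 2)
       + u n.+1 i s * gradient M (p n.+1) i s
       + g * centered_height M (h n.+1) s * u n.+1 i s * gradient M z i s
       = - Rem n.+1 i s)
    /\ ((forall s, s \in mesh_edges M i -> cfl M dt (h n) (h n.+1) (u n) i s) ->
        forall s, s \in mesh_edges M i -> 0 <= Rem n.+1 i s).
Proof.
pose E n i s :=
       (2 * dt)^-1 * (dual_height M (h n.+1) i s * u n.+1 i s ^+ 2
                      - dual_height M (h n) i s * u n i s ^+ 2)
       + (2 * area (dual_cell M i s))^-1 *
         (\sum_(e <- edges (dual_cell M i s))
            dual_flux M (h n) (u n) i s e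
            * upwind_velocity M (h n) (u n) i s e ^+ 2)
       + u n.+1 i s * gradient M (p n.+1) i s
       + g * centered_height M (h n.+1) s * u n.+1 i s * gradient M z i s.
(* The remainder is the opposite of the whole left side, so only its sign is at stake. It carries
   the index n+1 where [E] carries n, whence [n.-1]. *)
exists (fun n i s => - E n.-1 i s) => i n nN; split=> [s _|cflM s sM].
  by rewrite opprK.
rewrite oppr_ge0 /=.
have [b [K0 [K0M sK0]]] : exists b K, K \in M /\ s = face i b K.
  have /flattenP[_ /mapP[K KM ->] /mem_edges_dir[b ->]] := sM.
  by exists b, K.
have K0s : K0 \in cells_of M s by rewrite mem_filter K0M sK0 edges_face.
case cs: (cells_of M s) K0s => [//|K [|L [|? ?]]] K0s.
- (* On the boundary u vanishes, so only the terms F w^2 with F < 0 remain. *)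
  have EK : K0 = K by move: K0s; rewrite inE => /eqP.
  have sB : ~~ internal M s by rewrite /internal cs.
  rewrite /E !(sol_boundary hsol _ sM sB) ?(ltnW nN) //.
  rewrite expr0n /= !(mulr0, mul0r) subrr mulr0 add0r !addr0.
  rewrite mulr_ge0_le0 //.
    rewrite invr_ge0 mulr_ge0 // ltW // area_gt0 // /dual_cell cs sK0 EK.
    by apply: rectangle_half_cell; rewrite -EK; exact: (mesh_rectangle hM).
  rewrite -oppr_ge0 -sumrN sumr_ge0 // => e _.
  rewrite /upwind_velocity (sol_boundary hsol (ltnW nN) sM sB).
  case: (lerP 0 (dual_flux M _ _ _ _ _)) => Fe.
    by rewrite expr0n mulr0 oppr0.
  by rewrite -mulNr mulr_ge0 ?sqr_ge0 // oppr_ge0 ltW.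
- have sI : internal M s by rewrite /internal cs.
  have [Kl [Ku [KM LM sK sL cs']]] := internal_edge_cells hM sM cs.
  have rK := mesh_rectangle hM KM; have rL := mesh_rectangle hM LM.
  have aD := area_gt0 (rectangle_dual_cell rK rL sK sL cs').
  have KLM X : X \in [:: Kl; Ku] -> X \in M.
    by rewrite !inE => /orP[] /eqP ->.
  have mass := dual_mass_balance rK rL sK sL cs'
    (fun X XKL => sol_mass hsol nN (KLM X XKL)).
  have mom := sol_momentum hsol nN sM sI.
  have up e : 0 <= dual_flux M (h n) (u n) i s e ->
      upwind_velocity M (h n) (u n) i s e = u n i s.
    by rewrite /upwind_velocity => ->.
  (* The placeholder after [mass] is the momentum balance multiplied by |D|; it is derived from
     [mom] at the end. *)
  have := upwind_energy (v' := u n.+1 i s)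
    (G := area (dual_cell M i s) * (gradient M (p n.+1) i s
            + g * centered_height M (h n.+1) s * gradient M z i s))
    mass _ up (cfl_clear hdt0 (cflM s sM)).
  rewrite /E; move: mom aD hdt0; clear.
  set A := area _; set S := \sum_(_ <- _) _; set S2 := \sum_(_ <- _) _.
  move: (gradient _ _ _ _) (gradient _ _ _ _) => G1 G2.
  move: (centered_height _ _ _) => c.
  move=> mom A0 dt0 energy.
  (* Multiplied by |D| > 0, the goal becomes the conclusion of [energy] up to a field identity. *)
  rewrite -(pmulr_rle0 _ A0); apply: le_trans (energy _); last first.
    by rewrite -[RHS](mulr0 A) -mom; field; rewrite !gt_eqF.
  by rewrite le_eqVlt; apply/orP; left; apply/eqP; field; rewrite !gt_eqF.
- (* Junk case of three or more cells: D_s is s, of area 0, and 0^-1 = 0. *)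
  rewrite /E /dual_height /centered_height /gradient /dual_cell cs.
  by rewrite sK0 area_edge; rewrite !(mulr0, mul0r, invr0, subrr, addr0).
Qed.
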